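(* The category $\mathbf{M}$ of m-lattices and their homomorphisms is dually equivalent to the category $\mathbf{mKF}$ of monadic augmented Kripke frames (mk-frames) and mk-functions.
   Context: An m-lattice is a triple $(L,\triangle,\nabla)$ where $L$ is a bounded distributive lattice and $\triangle,\nabla$ are unary operations satisfying: $\nabla 0=0$, $x\wedge\nabla x=x$, $\nabla(x\wedge\nabla y)=\nabla x\wedge\nabla y$, $\nabla(x\vee y)=\nabla x\vee\nabla y$, $\nabla\nabla x=\nabla x$, $\triangle 1=1$, $x\wedge\triangle x=\triangle x$, $\triangle(x\wedge y)=\triangle x\wedge\triangle y$, $\triangle\triangle x=\triangle x$, $\nabla\triangle x=\triangle x$, $\triangle\nabla x=\nabla x$; morphisms are bounded lattice homomorphisms preserving $\triangle,\nabla$. Notation: for a relation $R$ on $X$, $R(Z)=\{y:(x,y)\in R$ for some $x\in Z\}$, $R(x)=R(\{x\})$; in a poset $(Y]=\{x:x\le y$ for some $y\in Y\}$, $[Y)=\{x:y\le x$ for some $y\in Y\}$, $[x)=[\{x\})$. A Priestley space is a compact space with a partial order such that whenever $x\not\le y$ there is a clopen increasing $U$ with $x\in U$, $y\notin U$; $D(X)$ is the set of clopen increasing subsets. An mk-frame is $(X,\Omega,\le,E)$ where $(X,\le)$ is a nonempty poset, $E$ an equivalence relation on $X$, and: (mk1) whenever $(x,z)\in E$ and $z\le y$ there is $w$ with $x\le w$ and $(w,y)\in E$; (mk2) $(X,\Omega,\le)$ is a Priestley space; (mk3) $E(A)$ is closed for every closed $A\subseteq X$; (mk4) $E(U)$ is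 open for every $U\in D(X)$; (mk5) $(E(X\setminus U)]$ is open for every $U\in D(X)$. An mk-function $f:(X_1,\le_1,E_1)\to(X_2,\le_2,E_2)$ is an order-preserving continuous map such that (mkf1) $(x,y)\in E_1$ implies $(f(x),f(y))\in E_2$; (mkf2) $E_2(f(x))\subseteq (f(E_1(x))]$ for all $x\in X_1$; (mkf3) $E_2([f(x)))\subseteq [f(E_1([x)))\,)$ for all $x\in X_1$.
   Formalization: The m-lattices are required to satisfy 0 ≠ 1: since mk-frames are nonempty, the one-element m-lattice (a terminal object of M) has no dual, and the equivalence fails if it is admitted. *)

(* Defs.v *)
From mathcomp Require Import all_boot all_order.
From mathcomp Require Import boolp classical_sets topology.

Set Implicit Arguments.
Unset Strict Implicit.
Unset Printing Implicit Defensive.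

Import Order.LTheory.
Local Open Scope classical_set_scope.
Local Open Scope order_scope.

Record category := Category {
  obj :> Type;
  hom : obj -> obj -> Type;
  idc : forall a, hom a a;
  compc : forall a b c, hom b c -> hom a b -> hom a c;
  compc1 : forall a b (f : hom a b), compc f (idc a) = f;
  comp1c : forall a b (f : hom a b), compc (idc b) f = f;
  compcA : forall a b c d (f : hom c d) (g : hom b c) (h : hom a b),
    compc f (compc g h) = compc (compc f g) h
}.
Arguments hom {_}.
Arguments idc {_}.
Arguments compc {_ _ _ _}.

Definition opposite (C : category) : category :=
  @Category C (fun a b => hom b a) (fun a => idc a)
    (fun _ _ _ f g => compc g f)
    (fun _ _ f => comp1c f) (fun _ _ f => compc1 f)
    (fun _ _ _ _ f g h => esym (compcA h g f)).

Record functor (C D : category) := Functor {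
  fobj :> C -> D;
  fhom : forall a b : C, hom a b -> hom (fobj a) (fobj b);
  fhom1 : forall a : C, fhom (idc a) = idc (fobj a);
  fhomM : forall (a b c : C) (f : hom b c) (g : hom a b),
    fhom (compc f g) = compc (fhom f) (fhom g)
}.

Definition id_functor (C : category) : functor C C :=
  @Functor C C id (fun _ _ f => f) (fun _ => erefl) (fun _ _ _ _ _ => erefl).

Section CompFunctor.
Variables (C D E : category) (G : functor D E) (F : functor C D).

Let gf_hom (a b : C) (f : hom a b) : hom (G (F a)) (G (F b)) :=
  fhom G (fhom F f).

Let gf_hom1 (a : C) : gf_hom (idc a) = idc (G (F a)).
Proof. by rewrite /gf_hom !fhom1. Qed.

Let gf_homM (a b c : C) (f : hom b c) (g : hom a b) :
  gf_hom (compc f g) = compc (gf_hom f) (gf_hom g).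
Proof. by rewrite /gf_hom !fhomM. Qed.

Definition comp_functor : functor C E :=
  @Functor C E (fun a => G (F a)) gf_hom gf_hom1 gf_homM.

End CompFunctor.

Definition is_iso (C : category) (a b : C) (f : hom a b) : Prop :=
  exists g : hom b a, compc g f = idc a /\ compc f g = idc b.

Definition naturally_isomorphic (C D : category) (F G : functor C D) : Prop :=
  exists eta : forall a : C, hom (F a) (G a),
    (forall (a b : C) (f : hom a b),
       compc (eta b) (fhom F f) = compc (fhom G f) (eta a)) /\
    (forall a : C, is_iso (eta a)).

Definition equivalent_categories (C D : category) : Prop :=
  exists (F : functor C D) (G : functor D C),
    naturally_isomorphic (comp_functor G F) (id_functor C) /\
    naturally_isomorphic (comp_functor F G) (id_functor D).

Definition dually_equivalent (C D : category) : Prop :=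
  equivalent_categories C (opposite D).

Record is_m_lattice (d : Order.disp_t) (L : tbDistrLatticeType d)
    (tri nab : L -> L) : Prop := IsMLattice {
  nab0 : nab \bot = \bot;
  meet_nab : forall x, x `&` nab x = x;
  nab_meet_nab : forall x y, nab (x `&` nab y) = nab x `&` nab y;
  nab_join : forall x y, nab (x `|` y) = nab x `|` nab y;
  nab_nab : forall x, nab (nab x) = nab x;
  tri1 : tri \top = \top;
  meet_tri : forall x, x `&` tri x = tri x;
  tri_meet : forall x y, tri (x `&` y) = tri x `&` tri y;
  tri_tri : forall x, tri (tri x) = tri x;
  nab_tri : forall x, nab (tri x) = tri x;
  tri_nab : forall x, tri (nab x) = nab x
}.

(** Bounded lattices are taken with [0 <> 1]: the dual of the one-element
    lattice is the empty frame, while mk-frames are nonempty, so that the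
    duality fails if the one-element lattice is admitted. *)
Record m_lattice := MLattice {
  ml_disp : Order.disp_t;
  ml_sort :> tbDistrLatticeType ml_disp;
  tri : ml_sort -> ml_sort;
  nab : ml_sort -> ml_sort;
  ml_nontrivial : \bot <> \top :> ml_sort;
  ml_axioms : is_m_lattice tri nab
}.
Arguments tri {_}.
Arguments nab {_}.

Record is_m_hom (L M : m_lattice) (h : L -> M) : Prop := IsMHom {
  m_hom0 : h \bot = \bot;
  m_hom1 : h \top = \top;
  m_homI : {morph h : x y / x `&` y};
  m_homU : {morph h : x y / x `|` y};
  m_hom_tri : {morph h : x / tri x};
  m_hom_nab : {morph h : x / nab x}
}.

Record m_hom (L M : m_lattice) := MHom {
  m_fun :> L -> M;
  m_homP : is_m_hom m_fun
}.

Lemma m_hom_ext (L M : m_lattice) (f g : m_hom L M) : f =1 g -> f = g.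
Proof.
case: f g => [f fP] [g gP] /= /funext efg; subst g.
by rewrite (Prop_irrelevance fP gP).
Qed.

Lemma is_m_hom_id (L : m_lattice) : is_m_hom (@id L).
Proof. by split. Qed.

Lemma is_m_hom_comp (L M N : m_lattice) (f : m_hom M N) (g : m_hom L M) :
  is_m_hom (f \o g).
Proof.
have [f0 f1 fI fU fT fN] := m_homP f; have [g0 g1 gI gU gT gN] := m_homP g.
by split=> [||x y|x y|x|x] /=; rewrite ?g0 ?g1 ?gI ?gU ?gT ?gN.
Qed.

Definition m_id (L : m_lattice) : m_hom L L := MHom (is_m_hom_id L).

Definition m_comp (L M N : m_lattice) (f : m_hom M N) (g : m_hom L M) :
  m_hom L N := MHom (is_m_hom_comp f g).

Lemma m_comp1 (L M : m_lattice) (f : m_hom L M) : m_comp f (m_id L) = f.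
Proof. exact: m_hom_ext. Qed.

Lemma m_1comp (L M : m_lattice) (f : m_hom L M) : m_comp (m_id M) f = f.
Proof. exact: m_hom_ext. Qed.

Lemma m_compA (L M N K : m_lattice) (f : m_hom N K) (g : m_hom M N)
    (k : m_hom L M) :
  m_comp f (m_comp g k) = m_comp (m_comp f g) k.
Proof. exact: m_hom_ext. Qed.

Definition M_cat : category :=
  Category m_comp1 m_1comp m_compA.

Definition rel_image (X : Type) (R : X -> X -> Prop) (Z : set X) : set X :=
  [set y | exists2 x, Z x & R x y].

(** [down Y], from [classical_sets], is [(Y]]. *)
Definition up (d : Order.disp_t) (X : porderType d) (Y : set X) : set X :=
  [set x | exists y, Y y /\ y <= x].

Definition increasing_set (d : Order.disp_t) (X : porderType d) (U : set X) :=
  forall x y, U x -> x <= y -> U y.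

Definition clopen_increasing (d : Order.disp_t)
    (X : POrderedTopological.type d) : set (set X) :=
  [set U | clopen U /\ increasing_set U].

Definition priestley_space (d : Order.disp_t)
    (X : POrderedTopological.type d) : Prop :=
  compact [set: X] /\
  forall x y : X, ~ (x <= y) ->
    exists U, [/\ clopen_increasing U, U x & ~ U y].

Record is_mk_frame (d : Order.disp_t) (X : POrderedTopological.type d)
    (E : X -> X -> Prop) : Prop := IsMkFrame {
  mk_nonempty : [set: X] !=set0;
  mk_refl : forall x, E x x;
  mk_sym : forall x y, E x y -> E y x;
  mk_trans : forall x y z, E x y -> E y z -> E x z;
  mk1 : forall x y z, E x z -> z <= y -> exists w, x <= w /\ E w y;
  mk2 : priestley_space X;
  mk3 : forall A : set X, closed A -> closed (rel_image E A);
  mk4 : forall U : set X, clopen_increasing U -> open (rel_image E U);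
  mk5 : forall U : set X, clopen_increasing U -> open (down (rel_image E (~` U)%classic))
}.

Record mk_frame := MkFrame {
  mk_disp : Order.disp_t;
  mk_sort :> POrderedTopological.type mk_disp;
  mkE : mk_sort -> mk_sort -> Prop;
  mk_axioms : is_mk_frame mkE
}.
Arguments mkE {_}.

Record is_mk_function (X Y : mk_frame) (f : X -> Y) : Prop := IsMkFunction {
  mkf_homo : {homo f : x y / x <= y};
  mkf_continuous : continuous f;
  mkf1 : forall x y, mkE x y -> mkE (f x) (f y);
  mkf2 : forall x,
    rel_image mkE [set f x] `<=` down (f @` rel_image mkE [set x]);
  mkf3 : forall x,
    rel_image mkE (up [set f x]) `<=` up (f @` rel_image mkE (up [set x]))
}.

Record mk_function (X Y : mk_frame) := MkFunction {
  mk_fun :> X -> Y;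
  mk_functionP : is_mk_function mk_fun
}.

Lemma mk_function_ext (X Y : mk_frame) (f g : mk_function X Y) :
  f =1 g -> f = g.
Proof.
case: f g => [f fP] [g gP] /= /funext efg; subst g.
by rewrite (Prop_irrelevance fP gP).
Qed.

Lemma is_mk_function_id (X : mk_frame) : is_mk_function (@id X).
Proof.
split=> // [x|x y Exy|x y Exy]; first exact: cvg_id.
- by exists y; split=> //; exists y.
- by exists y; split=> //; exists y.
Qed.

Lemma is_mk_function_comp (X Y Z : mk_frame)
    (f : mk_function Y Z) (g : mk_function X Y) : is_mk_function (f \o g).
Proof.
have [fh fc f1 f2 f3] := mk_functionP f.
have [gh gc g1 g2 g3] := mk_functionP g.
split.
- by move=> x y xy; exact/fh/gh.
- by move=> x; apply: continuous_comp; [exact: gc|exact: fc].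
- by move=> x y xy; exact/f1/g1.
- move=> x z /f2[_ [[y Ey <-] zfy]].
  have [_ [[w Ew <-] ygw]] := g2 _ _ Ey.
  by exists (f (g w)); split; [exists w|exact: le_trans zfy (fh _ _ ygw)].
- move=> x z /f3[_ [[y Ey <-] fyz]].
  have [_ [[w Ew <-] gwy]] := g3 _ _ Ey.
  by exists (f (g w)); split; [exists w|exact: le_trans (fh _ _ gwy) fyz].
Qed.

Definition mkf_id (X : mk_frame) : mk_function X X := MkFunction (is_mk_function_id X).

Definition mkf_comp (X Y Z : mk_frame) (f : mk_function Y Z) (g : mk_function X Y) :
  mk_function X Z := MkFunction (is_mk_function_comp f g).

Lemma mkf_comp1 (X Y : mk_frame) (f : mk_function X Y) : mkf_comp f (mkf_id X) = f.
Proof. exact: mk_function_ext. Qed.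

Lemma mkf_1comp (X Y : mk_frame) (f : mk_function X Y) : mkf_comp (mkf_id Y) f = f.
Proof. exact: mk_function_ext. Qed.

Lemma mkf_compA (X Y Z W : mk_frame) (f : mk_function Z W) (g : mk_function Y Z)
    (k : mk_function X Y) :
  mkf_comp f (mkf_comp g k) = mkf_comp (mkf_comp f g) k.
Proof. exact: mk_function_ext. Qed.

Definition mKF_cat : category :=
  Category mkf_comp1 mkf_1comp mkf_compA.

(* Main.v *)
(** The dual of an m-lattice [L] is its space of prime filters, ordered by
    inclusion, where two prime filters are related if they contain the same
    constants, i.e. the same fixed points of [nab]; the dual of an mk-frame is
    its lattice of clopen up-sets, with [nab U = E(U)] and [tri U] the
    complement of [(E(X \ U)]]. The identity [nab (x /\ nab y) = nab x /\ nab y]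
    and the adjunctions of [nab] and [tri] with the inclusion of the constants
    provide, through the prime filter theorem, all prime filters required by
    (mk1), (mk4), (mk5), (mkf2) and (mkf3). Every compactness argument has the
    same form: a down-directed family of closed sets that all meet a compact set
    has a common point in it. The delicate point is that the points of a frame
    which lie in the same [E]-saturated clopen up-sets are [E]-related
    ([mkE_sep]): nothing makes [E]-classes convex, but closed sets have maximal
    elements. *)

From HB Require Import structures.
From mathcomp Require Import all_boot all_order.
From mathcomp Require Import boolp classical_sets topology.
Require Import Defs.

Set Implicit Arguments.
Unset Strict Implicit.
Unset Printing Implicit Defensive.

Import Order.LTheory.
Local Open Scope classical_set_scope.
Local Open Scope order_scope.

(** Directedness makes the sets [K]&[f i] a base of a proper filter; a cluster point of it in [K]
    lies in every [f i], as these are closed. *)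
Lemma compact_bigcap_directed (T : topologicalType) (K : set T) (I : Type)
    (D : set I) (f : I -> set T) :
    compact K -> (forall i, D i -> closed (f i)) -> D !=set0 ->
    (forall i j, D i -> D j -> exists2 k, D k & forall x, f k x -> f i x /\ f j x) ->
    (forall i, D i -> exists2 x, K x & f i x) ->
  exists2 x, K x & forall i, D i -> f i x.
Proof.
move=> cK fcl [i0 Di0] dir ne.
pose F := filter_from D (fun i => (K `&` f i)%classic).
have FF : ProperFilter F.
  apply: filter_from_proper => [|i /ne[x Kx fx]]; last by exists x.
  apply: filter_from_filter; first by exists i0.
  move=> i j /dir h /h[k Dk fk]; exists k => // x [Kx /fk[]]; by split; split.
have [|x [Kx Fx]] := cK F _; first by exists i0 => // y [].
exists x => // i Di; apply: fcl => // B xB.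
have [|y [fy By]] := Fx (f i) B _ xB; last by exists y.
by exists i => // y [].
Qed.

(** * Prime filters of a bounded distributive lattice *)

Section PrimeFilters.
Context {d : Order.disp_t} {L : tbDistrLatticeType d}.

Record is_prime_filter (P : set L) : Prop := IsPrimeFilter {
  pfT : P \top;
  pf0 : ~ P \bot;
  pfS : forall x y, P x -> x <= y -> P y;
  pfI : forall x y, P x -> P y -> P (x `&` y);
  pfU : forall x y, P (x `|` y) -> P x \/ P y
}.

Record prime_filter := PrimeFilter {
  pf_set :> L -> Prop;
  pf_prime : is_prime_filter pf_set
}.

Lemma pf_ext (P Q : prime_filter) : (forall a, P a <-> Q a) -> P = Q.
Proof.
case: P Q => [P hP] [Q hQ] /= PQ.
have ePQ : P = Q by apply/seteqP; split=> a /PQ.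
by subst Q; rewrite (Prop_irrelevance hP hQ).
Qed.

Lemma pf_top (P : prime_filter) : P \top.
Proof. by have [] := pf_prime P. Qed.

Lemma pf_bot (P : prime_filter) : ~ P \bot.
Proof. by have [] := pf_prime P. Qed.

Lemma pf_up (P : prime_filter) a b : P a -> a <= b -> P b.
Proof. by have [_ _ h _ _] := pf_prime P; exact: h. Qed.

Lemma pfIE (P : prime_filter) a b : P (a `&` b) <-> P a /\ P b.
Proof.
have hP := pf_prime P; split=> [Pab|[]]; last exact: pfI.
by split; apply: (pfS hP Pab); rewrite ?leIl ?leIr.
Qed.

Lemma pfUE (P : prime_filter) a b : P (a `|` b) <-> P a \/ P b.
Proof.
have hP := pf_prime P; split=> [|[]]; first exact: pfU.
- by move=> Pa; apply: (pfS hP Pa); rewrite leUl.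
- by move=> Pa; apply: (pfS hP Pa); rewrite leUr.
Qed.

(* The prime filter theorem: a filter of [L] that contains [S] and is maximal
   among those disjoint from [T] is prime. *)
Lemma prime_filter_separation (S T : set L) :
    S !=set0 -> T !=set0 ->
    (forall x y, S x -> S y -> S (x `&` y)) ->
    (forall x y, T x -> T y -> T (x `|` y)) ->
    (forall s t, S s -> T t -> ~ (s <= t)) ->
  exists2 P : prime_filter, S `<=` P & forall t, T t -> ~ P t.
Proof.
move=> [s0 Ss0] [t0 Tt0] SI TU ST.
pose Z (A : set L) := [/\ forall x y, A x -> x <= y -> A y,
  forall x y, A x -> A y -> A (x `&` y), forall t, T t -> ~ A t &
  A !=set0 -> S `<=` A].
have ZU (F : set (set L)) : F `<=` Z -> total_on F subset ->
    Z (\bigcup_(X in F) X).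
  move=> FZ tF; split.
  - by move=> x y [A FA Ax] xy; exists A => //; have [h _ _ _] := FZ _ FA; exact: h xy.
  - move=> x y [A FA Ax] [B FB By].
    have [_ IA _ _] := FZ _ FA; have [_ IB _ _] := FZ _ FB.
    have [AB|BA] := tF _ _ FA FB.
    + by exists B => //; apply: IB => //; exact: AB.
    + by exists A => //; apply: IA => //; exact: BA.
  - by move=> t Tt [A FA At]; have [_ _ h _] := FZ _ FA; exact: h At.
  - move=> [x [A FA Ax]] s Ss; exists A => //; have [_ _ _ h] := FZ _ FA.
    by apply: h => //; exists x.
have [A [ZA maxA]] := Zorn_bigcup ZU.
have maxZ B : A `<=` B -> Z B -> B `<=` A.
  move=> AB ZB; apply: contrapT => nBA; exact: (maxA B).
(* The filter generated by [S] shows that the maximal [A] is not the empty set. *)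
pose B0 : set L := [set x | exists2 s, S s & s <= x].
have ZB0 : Z B0.
  split.
  - by move=> x y [s Ss sx] xy; exists s => //; exact: le_trans xy.
  - move=> x y [s Ss sx] [s' Ss' sy]; exists (s `&` s'); first exact: SI.
    exact: leI2.
  - by move=> t Tt [s Ss]; exact: ST.
  - by move=> _ s Ss; exists s.
have [AS AI AT AF] := ZA.
have An0 : A !=set0.
  apply: contrapT => A0; suff : B0 `<=` A.
    by move=> /(_ s0) h; apply: A0; exists s0; apply: h; exists s0.
  by apply: maxZ => // x Ax; case: A0; exists x.
have SA := AF An0.
(* By maximality, the filter generated by [A] and a point [a] outside [A] meets [T]. *)
have sep a : ~ A a -> exists p t, [/\ A p, T t & p `&` a <= t].
  move=> Aa; apply: contrapT => h; apply: Aa.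
  pose B : set L := [set x | exists2 p, A p & p `&` a <= x].
  suff /maxZ BA : A `<=` B.
    apply: BA; last first.
      by have [p Ap] := An0; exists p => //; exact: leIr.
    split.
    - by move=> x y [p Ap px] xy; exists p => //; exact: le_trans xy.
    - move=> x y [p Ap px] [q Aq qy]; exists (p `&` q); first exact: AI.
      rewrite lexI (le_trans _ px) ?(le_trans _ qy) //.
      + by apply: leI2 => //; exact: leIr.
      + by apply: leI2 => //; exact: leIl.
    - by move=> t Tt [p Ap pt]; apply: h; exists p, t.
    - by move=> _ s Ss; exists s; [exact: SA|exact: leIl].
  by move=> x Ax; exists x => //; exact: leIl.
have pA : is_prime_filter A.
  split=> //.
  - exact: (AS _ _ (SA _ Ss0) (lex1 _)).
  - by move=> A0; apply: (AT t0 Tt0); apply: (AS _ _ A0); exact: le0x.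
  - move=> x y Axy; apply: contrapT => /not_orP[/sep[p [t [Ap Tt pt]]]].
    move=> /sep[q [u [Aq Tu qu]]]; apply: (AT (t `|` u)); first exact: TU.
    apply: (AS _ _ (AI _ _ (AI _ _ Ap Aq) Axy)).
    (* Distributivity splits the meet of [p], [q] and the join of [x] and [y] into two parts, one
       below [t] and one below [u]. *)
    rewrite meetUr; apply: leU2.
    + by apply: le_trans pt; apply: leI2 => //; exact: leIl.
    + by apply: le_trans qu; apply: leI2 => //; exact: leIr.
by exists (PrimeFilter pA).
Qed.

(** * The Priestley space of prime filters *)

HB.instance Definition _ := gen_eqMixin prime_filter.
HB.instance Definition _ := gen_choiceMixin prime_filter.

Definition pf_le (P Q : prime_filter) : bool := `[< P `<=` Q >].

Fact pf_le_refl : reflexive pf_le.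
Proof. by move=> P; apply/asboolP. Qed.

Fact pf_le_anti : antisymmetric pf_le.
Proof.
move=> P Q /andP[/asboolP PQ /asboolP QP].
by apply: pf_ext => a; split=> [/PQ|/QP].
Qed.

Fact pf_le_trans : transitive pf_le.
Proof.
by move=> Q P R /asboolP PQ /asboolP QR; apply/asboolP => a /PQ/QR.
Qed.

HB.instance Definition _ := Order.Le_isPOrder.Build d prime_filter
  pf_le_refl pf_le_anti pf_le_trans.

Lemma pf_leP (P Q : prime_filter) : reflect (P `<=` Q) (P <= Q).
Proof. exact: asboolP. Qed.

(** The patch topology. The differences of sets [phi a] are closed under finite intersections, so
    they are a base and not merely a subbase. *)
Definition pf_open : set (set prime_filter) :=
  [set A : set prime_filter | forall P : prime_filter, A P -> exists a b,
    [/\ P a, ~ P b & forall Q : prime_filter, Q a -> ~ Q b -> A Q]].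

Fact pf_openT : pf_open setT.
Proof.
by move=> P _; exists \top, \bot; have [] := pf_prime P.
Qed.

Fact pf_openI : setI_closed pf_open.
Proof.
move=> A B oA oB P [/oA[a [b [Pa Pb AQ]]] /oB[a' [b' [Pa' Pb' BQ]]]].
exists (a `&` a'), (b `|` b'); split; first by apply/pfIE.
  by move=> /pfUE[].
move=> Q /pfIE[Qa Qa'] Qb.
by split; [apply: AQ|apply: BQ] => // Q'; apply: Qb; apply/pfUE; auto.
Qed.

Fact pf_open_bigU (I : Type) (f : I -> set prime_filter) :
  (forall i, pf_open (f i)) -> pf_open (\bigcup_i f i).
Proof.
move=> of_ P [i _ /of_[a [b [Pa Pb fQ]]]]; exists a, b; split=> // Q Qa Qb.
by exists i => //; exact: fQ.
Qed.

HB.instance Definition _ := isOpenTopological.Build prime_filter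
  pf_openT pf_openI pf_open_bigU.

Lemma pf_openE (A : set prime_filter) : open A = pf_open A.
Proof. by []. Qed.

Definition phi (a : L) : set prime_filter := [set P | P a].

Lemma clopen_phi a : clopen (phi a).
Proof.
split.
- by rewrite pf_openE => P Pa; exists a, \bot; split=> //; exact: pf_bot.
- rewrite -openC pf_openE => P Pa; exists \top, a; split=> //=.
  exact: pf_top.
Qed.

Lemma phi_clopen_increasing a : clopen_increasing (phi a).
Proof.
by split; [exact: clopen_phi|move=> P Q Pa /pf_leP; exact].
Qed.

(* An ultrafilter [F] converges to the prime filter of all [a] such that [F]
   contains [phi a]. *)
Lemma pf_compact : compact [set: prime_filter].
Proof.
rewrite compact_ultra => F UF _.
pose P : set L := [set a | F (phi a)].
have hP : is_prime_filter P.
  split.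
  - by apply: (filterS _ (filterT : F setT)) => Q _; exact: pf_top.
  - move=> F0; apply: (@filter_not_empty _ F).
    by apply: (filterS _ F0) => Q /pf_bot.
  - by move=> x y Fx xy; apply: (filterS _ Fx) => Q Qx; exact: pf_up Qx xy.
  - by move=> x y Fx Fy; apply: (filterS _ (filterI Fx Fy)) => Q /pfIE.
  - move=> x y Fxy; have [Fx|Fx] := in_ultra_setVsetC (phi x) UF; first by left.
    by right; apply: (filterS _ (filterI Fx Fxy)) => Q [Qx /pfUE[/Qx|]].
exists (PrimeFilter hP); split=> // B; rewrite nbhsE => -[A [oA AP] AB].
apply: (filterS AB).
move: oA; rewrite pf_openE => /(_ _ AP)[a [b [Pa Pb AQ]]].
have [/Pb//|Fb] := in_ultra_setVsetC (phi b) UF.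
by apply: (filterS _ (filterI Pa Fb)) => Q [Qa Qb]; exact: AQ.
Qed.

Lemma pf_priestley : priestley_space prime_filter.
Proof.
split; first exact: pf_compact.
move=> P Q PQ; have [a [Pa Qa]] : exists a, P a /\ ~ Q a.
  apply: contrapT => h; apply: PQ; apply/pf_leP => a Pa.
  by apply: contrapT => Qa; apply: h; exists a.
by exists (phi a); split=> //; exact: phi_clopen_increasing.
Qed.

(** Two compactness arguments. If every [phi a] with [a] in [P] met the complement of [U], a common
    point would lie above [P] and outside the up-set [U]. So [U] is a union of sets [phi a]; this
    union is directed because of joins, hence a single [phi a] exhausts [U]. *)
Lemma phi_surj (U : set prime_filter) :
  clopen_increasing U -> exists a, U = phi a.
Proof.
move=> [[oU cU] incU].
have cptU : compact U by apply: (subclosed_compact cU pf_compact).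
have cptCU : compact (~` U)%classic.
  by apply: (subclosed_compact _ pf_compact) => //; exact: open_closedC.
have inner P : U P -> exists2 a, P a & phi a `<=` U.
  move=> UP; apply: contrapT => h.
  have [||a b Pa Pb|a Pa|Q UQ PQ] := @compact_bigcap_directed _ _ _ P phi cptCU.
  - by move=> a _; have [] := clopen_phi a.
  - by exists \top; exact: pf_top.
  - by exists (a `&` b); [exact/pfIE|move=> Q /pfIE].
  - apply: contrapT => h'; apply: h; exists a => // Q Qa.
    by apply: contrapT => UQ; apply: h'; exists Q.
  - by apply: UQ; apply: incU UP _; exact/pf_leP.
apply: contrapT => h.
pose D : set L := [set a | phi a `<=` U].
have [||a b Da Db|a Da|Q UQ PQ] :=
  @compact_bigcap_directed _ _ _ D (fun a => (~` phi a)%classic) cptU.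
- by move=> a _; apply: open_closedC; have [] := clopen_phi a.
- by exists \bot => Q /pf_bot.
- exists (a `|` b); first by move=> Q /pfUE[/Da|/Db].
  by move=> Q Qab; split=> Qx; apply: Qab; apply/pfUE; auto.
- apply: contrapT => h'; apply: h; exists a; apply/seteqP; split=> // Q UQ.
  by apply: contrapT => Qa; apply: h'; exists Q.
- by have [a Qa aU] := inner _ UQ; exact: (PQ a aU).
Qed.

Lemma phi_le a b : phi a `<=` phi b -> a <= b.
Proof.
move=> ab; apply: contrapT => nab.
have [|||||P Pa Pb] := @prime_filter_separation [set a] [set b].
- by exists a.
- by exists b.
- by move=> x y -> ->; rewrite /= meetxx.
- by move=> x y -> ->; rewrite /= joinxx.
- by move=> s t -> ->.
- by apply: (Pb b erefl); apply: ab; exact: Pa.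
Qed.

Lemma phi_inj a b : phi a = phi b -> a = b.
Proof. by move=> ab; apply/le_anti/andP; split; apply: phi_le; rewrite ab. Qed.

End PrimeFilters.
Arguments is_prime_filter {d L}.
Arguments prime_filter {d} L.

(** * The mk-frame of prime filters of an m-lattice *)

Section MLatticeTheory.
Variable L : m_lattice.
Implicit Types (a b : L) (P Q : prime_filter L).

Local Notation ax := (ml_axioms L).

Lemma le_nab a : a <= nab a.
Proof. by rewrite leEmeet (meet_nab ax). Qed.

Lemma tri_le a : tri a <= a.
Proof. by rewrite leEmeet meetC (meet_tri ax). Qed.

Lemma nab_mono a b : a <= b -> nab a <= nab b.
Proof. by rewrite !leEjoin -(nab_join ax) => /eqP ->. Qed.

Lemma tri_mono a b : a <= b -> tri a <= tri b.
Proof. by rewrite !leEmeet -(tri_meet ax) => /eqP ->. Qed.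

(* The fixed points of [nab], which are also those of [tri], form the
   subalgebra of constants; two prime filters are related if they contain
   the same constants. *)
Definition pfE P Q : Prop := forall a, P (nab a) <-> Q (nab a).

Lemma pfE_tri P Q a : pfE P Q -> P (tri a) <-> Q (tri a).
Proof. by move=> PQ; rewrite -(nab_tri ax). Qed.

Lemma pfE_sym P Q : pfE P Q -> pfE Q P.
Proof. by move=> PQ a; split=> /PQ. Qed.

(** Separates the meets of elements of [S] with constants of [Q] from the constants outside [Q]:
    applying [nab] to [s]&[nab m <= nab n] gives [nab s]&[nab m <= nab n], which would put [nab n]
    in [Q]. *)
Lemma pfE_extend (S : set L) Q :
    S !=set0 -> (forall x y, S x -> S y -> S (x `&` y)) ->
    (forall s, S s -> Q (nab s)) ->
  exists2 P : prime_filter L, S `<=` P & pfE P Q.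
Proof.
move=> [s0 Ss0] SI SQ.
pose S' := [set x | exists s m, [/\ S s, Q (nab m) & x = s `&` nab m]].
pose T := [set x | exists2 m, ~ Q (nab m) & x = nab m].
have Q1 : Q (nab \top) by apply: pf_up (le_nab _); exact: pf_top.
have [|||||P SP PT] := @prime_filter_separation _ L S' T.
- by exists (s0 `&` nab \top), s0, \top.
- by exists (nab \bot), \bot => //; rewrite (nab0 ax); exact: pf_bot.
- move=> _ _ [s [m [Ss Qm ->]]] [t [n [St Qn ->]]].
  exists (s `&` t), (m `&` nab n); split; first exact: SI.
    by rewrite (nab_meet_nab ax); apply/pfIE.
  by rewrite (nab_meet_nab ax) meetACA.
- move=> _ _ [m Qm ->] [n Qn ->]; exists (m `|` n); last by rewrite (nab_join ax).
  by rewrite (nab_join ax) => /pfUE[].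
- move=> _ _ [s [m [Ss Qm ->]]] [n Qn ->] /nab_mono.
  rewrite (nab_meet_nab ax) (nab_nab ax) => le_n; apply: Qn; apply: pf_up le_n.
  by apply/pfIE; split=> //; exact: SQ.
exists P => [s Ss|a].
  have /pfIE[] // : P (s `&` nab \top) by apply: SP; exists s, \top.
split=> [Pa|Qa]; first by apply: contrapT => Qa; apply: (PT (nab a)) => //; exists a.
have /pfIE[] // : P (s0 `&` nab a) by apply: SP; exists s0, a.
Qed.

Lemma pfE_extend_pf P Q : (forall a, P (nab a) -> Q (nab a)) ->
  exists2 P' : prime_filter L, P <= P' & pfE P' Q.
Proof.
move=> PQ; have [|||P' PP' P'Q] := @pfE_extend P Q.
- by exists \top; exact: pf_top.
- by move=> x y Px Py; apply/pfIE.
- by move=> s Ps; apply: PQ; apply: pf_up (le_nab _).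
- by exists P' => //; exact/pf_leP.
Qed.

(** Separates the constants of [P] from [T]: from [nab m <= t] follows
    [nab m = tri (nab m) <= tri t], which would put [tri t] in [P]. The resulting [Q] contains the
    constants of [P], so [P] extends to a prime filter related to [Q]. *)
Lemma pfE_avoid (T : set L) P :
    T !=set0 -> (forall x y, T x -> T y -> T (x `|` y)) ->
    (forall t, T t -> ~ P (tri t)) ->
  exists P' Q : prime_filter L, [/\ P <= P', pfE P' Q & forall t, T t -> ~ Q t].
Proof.
move=> T0 TU TP; pose S := [set x | exists2 m, P (nab m) & x = nab m].
have [|||||Q SQ QT] := @prime_filter_separation _ L S T => //.
- by exists (nab \top), \top => //; apply: pf_up (le_nab _); exact: pf_top.
- move=> _ _ [m Pm ->] [n Pn ->]; exists (m `&` nab n); rewrite (nab_meet_nab ax) //.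
  exact/pfIE.
- move=> _ t [m Pm ->] Tt /tri_mono; rewrite (tri_nab ax) => mt.
  by apply: (TP t Tt); exact: pf_up mt.
have [|P' PP' P'Q] := @pfE_extend_pf P Q; last by exists P', Q.
by move=> a Pa; apply: SQ; exists a.
Qed.

(** Serves twice: for (mk4), and for the compatibility of [phi] with [nab]. In the same way
    [phi_tri] serves (mk5) and [tri]. *)
Lemma phi_nab a : phi (nab a) = rel_image pfE (phi a).
Proof.
apply/seteqP; split=> Q; last first.
  by move=> [P Pa PQ]; apply/PQ; apply: pf_up (le_nab _).
move=> Qa; have [|||P aP PQ] := @pfE_extend [set a] Q.
- by exists a.
- by move=> x y -> ->; rewrite /= meetxx.
- by move=> s ->.
- by exists P => //; exact: aP.
Qed.

Lemma phi_tri a : phi (tri a) = (~` down (rel_image pfE (~` phi a)))%classic.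
Proof.
apply/seteqP; split=> P.
  move=> Pa [P' [[Q Qa QP'] PP']]; apply: Qa; apply: pf_up (tri_le _).
  by apply/(pfE_tri _ QP'); apply: (pf_leP _ _ PP').
move=> h; apply: contrapT => Pa; apply: h.
have [|||P' [Q [PP' P'Q Qa]]] := @pfE_avoid [set a] P.
- by exists a.
- by move=> x y -> ->; rewrite /= joinxx.
- by move=> s ->.
- by exists P'; split=> //; exists Q; [exact: Qa|exact: pfE_sym].
Qed.

Lemma pfE_closed (A : set (prime_filter L)) :
  closed A -> closed (rel_image pfE A).
Proof.
move=> cA; rewrite -openC pf_openE => Q AQ.
have cptA : compact A by apply: (subclosed_compact cA pf_compact).
pose D := [set mn : L * L | Q (nab mn.1) /\ ~ Q (nab mn.2)].
pose f (mn : L * L) := (phi (nab mn.1) `&` ~` phi (nab mn.2))%classic.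
(* Compactness of [A] yields one pair of constants that distinguishes [Q] from all of [A] at once;
   the difference it defines is then a neighbourhood of [Q] missing the image of [A]. *)
have [[m n] /= [Dm Dn] h] : exists2 mn, D mn & forall P, A P -> ~ f mn P.
  apply: contrapT => h.
  have [||[m n] [m' n'] [/= Qm Qn] [/= Qm' Qn']|mn Dmn|P AP fP] :=
    @compact_bigcap_directed _ _ _ D f cptA.
  - move=> mn _; apply: closedI; first by have [] := clopen_phi (nab mn.1).
    by apply: open_closedC; have [] := clopen_phi (nab mn.2).
  - exists (\top, \bot); split=> /=; last by rewrite (nab0 ax); exact: pf_bot.
    by apply: pf_up (le_nab _); exact: pf_top.
  - exists (m `&` nab m', n `|` n'); rewrite /D /f /phi /= (nab_meet_nab ax) (nab_join ax).
      by split; [apply/pfIE|move=> /pfUE[]].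
    by move=> P [/pfIE[Pm Pm'] Pn]; do !split=> //; move=> Pn'; apply: Pn; apply/pfUE; auto.
  - apply: contrapT => h'; apply: h; exists mn => // P AP fP; apply: h'.
    by exists P.
  - apply: AQ; exists P => // a; split=> [Pa|Qa].
    (* Pairing [a] with [\top] or with [\bot] makes one of the two conditions of [f] vacuous, so
       that each implication is tested separately. *)
    + apply: contrapT => Qa; have [] := fP (\top, a); last by move=> _; apply.
      by split=> //=; apply: pf_up (le_nab _); exact: pf_top.
    + have [] // := fP (a, \bot).
      by split=> //=; rewrite (nab0 ax); exact: pf_bot.
exists (nab m), (nab n); split=> // P Pm Pn [P' AP' P'P].
by apply: (h P' AP'); split; [apply/P'P|move=> /P'P].
Qed.

Lemma pf_nonempty : [set: prime_filter L] !=set0.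
Proof.
have [|||||P _ _] := @prime_filter_separation _ L [set \top] [set \bot].
- by exists \top.
- by exists \bot.
- by move=> x y -> ->; rewrite /= meetxx.
- by move=> x y -> ->; rewrite /= joinxx.
- move=> s t -> ->; rewrite le1x => /eqP e; exact: (@ml_nontrivial L).
- by exists P.
Qed.

Lemma pf_is_mk_frame : is_mk_frame pfE.
Proof.
split=> //.
- exact: pf_nonempty.
- exact: pfE_sym.
- by move=> P Q R PQ QR a; split=> [/PQ/QR|/QR/PQ].
- move=> P Q R PR /pf_leP RQ; have [a /PR/RQ //|P' PP' P'Q] := @pfE_extend_pf P Q.
  by exists P'.
- exact: pf_priestley.
- exact: pfE_closed.
- move=> U /phi_surj[a ->]; rewrite -phi_nab; by have [] := clopen_phi (nab a).
- move=> U /phi_surj[a ->]; rewrite -[X in open X]setCK -phi_tri openC.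
  by have [] := clopen_phi (tri a).
Qed.

Definition pf_frame : mk_frame := MkFrame pf_is_mk_frame.

End MLatticeTheory.

(** * The mk-function dual to a homomorphism *)

Section PrimeFilterMap.
Variables (L M : m_lattice) (h : m_hom L M).

Lemma preimage_prime_filter (P : prime_filter M) :
  is_prime_filter [set a : L | P (h a)].
Proof.
have [h0 h1 hI hU _ _] := m_homP h; split=> /=.
- by rewrite h1; exact: pf_top.
- by rewrite h0; exact: pf_bot.
- move=> x y Px; rewrite leEmeet => /eqP xy.
  by move: Px; rewrite -xy hI => /pfIE[].
- by move=> x y Px Py; rewrite hI; apply/pfIE.
- by move=> x y; rewrite hU => /pfUE.
Qed.

Definition pf_map (P : pf_frame M) : pf_frame L :=
  PrimeFilter (preimage_prime_filter P).

Lemma pf_map_is_mk_function : is_mk_function pf_map.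
Proof.
have [h0 h1 hI hU hT hN] := m_homP h; split.
- by move=> P Q /pf_leP PQ; apply/pf_leP => a; exact: PQ.
- apply/continuousP => A oA; rewrite pf_openE => P AP; have [a [b [Pa Pb AQ]]] := oA _ AP.
  by exists (h a), (h b); split=> // Q Qa Qb; exact: AQ.
- by move=> P Q PQ a /=; rewrite hN.
(* For (mkf2), a prime filter containing the image of [Q] has a preimage above [Q]. *)
- move=> P Q [_ -> PQ].
  have [|||P' QP' P'P] := @pfE_extend M (h @` Q) P.
  + by exists (h \top), \top => //; exact: pf_top.
  + move=> _ _ [x Qx <-] [y Qy <-]; exists (x `&` y) => //; exact/pfIE.
  + by move=> _ [x Qx <-]; rewrite -hN; apply/(PQ x); apply: pf_up (le_nab _).
  + exists (pf_map P'); split; last by apply/pf_leP => a Qa; apply: QP'; exists a.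
    by exists P' => //; exists P => //; exact: pfE_sym.
(* For (mkf3), a prime filter avoiding the image of the complement of [Q] has a preimage below
   [Q]. *)
- move=> P Q [R [_ [-> /pf_leP PR]] RQ].
  have [|||P' [P'' [PP' P'P'' P''Q]]] := @pfE_avoid M [set y | exists2 a, ~ Q a & y = h a] P.
  + by exists (h \bot), \bot => //; exact: pf_bot.
  + by move=> _ _ [x Qx ->] [y Qy ->]; exists (x `|` y); [move=> /pfUE[]|].
  + move=> _ [a Qa ->]; rewrite -hT => Pa; apply: Qa; apply: pf_up (tri_le _).
    by apply/(pfE_tri _ RQ); exact: PR.
  + exists (pf_map P''); split; last first.
      by apply/pf_leP => a Pa; apply: contrapT => Qa; apply: (P''Q (h a)) => //; exists a.
    by exists P'' => //; exists P' => //; exists P.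
Qed.

Definition pf_mkf : mk_function (pf_frame M) (pf_frame L) :=
  MkFunction pf_map_is_mk_function.

End PrimeFilterMap.

(** * The bounded distributive lattice of clopen up-sets *)

Section ClopenUpSets.
Context {d : Order.disp_t} {X : POrderedTopological.type d}.

Record upclopen := UpClopen {
  uc_set :> X -> Prop;
  ucP : clopen_increasing uc_set
}.

Lemma uc_ext (U V : upclopen) : (forall x, U x <-> V x) -> U = V.
Proof.
case: U V => [U hU] [V hV] /= UV.
have eUV : U = V by apply/seteqP; split=> x /UV.
by subst V; rewrite (Prop_irrelevance hU hV).
Qed.

Lemma uc_open (U : upclopen) : open U. Proof. by have [[]] := ucP U. Qed.

Lemma uc_closed (U : upclopen) : closed U. Proof. by have [[]] := ucP U. Qed.

Lemma uc_up (U : upclopen) x y : U x -> x <= y -> U y.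
Proof. by have [_ h] := ucP U; exact: h. Qed.

HB.instance Definition _ := gen_eqMixin upclopen.
HB.instance Definition _ := gen_choiceMixin upclopen.

Fact ucI_subproof (U V : upclopen) :
  clopen_increasing [set x | U x /\ V x].
Proof.
split; [split|].
- by apply: openI; exact: uc_open.
- by apply: closedI; exact: uc_closed.
- by move=> x y [Ux Vx] xy; split; exact: uc_up xy.
Qed.
Definition ucI (U V : upclopen) := UpClopen (ucI_subproof U V).

Fact ucU_subproof (U V : upclopen) :
  clopen_increasing [set x | U x \/ V x].
Proof.
split; [split|].
- by apply: openU; exact: uc_open.
- by apply: closedU; exact: uc_closed.
- by move=> x y [Ux|Vx] xy; [left|right]; exact: uc_up xy.
Qed.
Definition ucU (U V : upclopen) := UpClopen (ucU_subproof U V).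

Fact uc0_subproof : @clopen_increasing d X set0.
Proof. by split=> //; split; [exact: open0|exact: closed0]. Qed.
Definition uc0 := UpClopen uc0_subproof.

Fact ucT_subproof : @clopen_increasing d X setT.
Proof. by split=> //; split; [exact: openT|exact: closedT]. Qed.
Definition ucT := UpClopen ucT_subproof.

Definition uc_le (U V : upclopen) : bool := `[< U `<=` V >].
Definition uc_lt (U V : upclopen) : bool := (V != U) && uc_le U V.

Fact uc_le_def U V : uc_le U V = (ucI U V == U).
Proof.
apply/asboolP/eqP => [UV|<- x []//].
by apply: uc_ext => x; split=> [[]|Ux] //; split=> //; exact: UV.
Qed.

Fact uc_lt_def U V : uc_lt U V = (V != U) && uc_le U V.
Proof. by []. Qed.

Fact ucIC : commutative ucI.
Proof. by move=> U V; apply: uc_ext => x /=; tauto. Qed.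

Fact ucUC : commutative ucU.
Proof. by move=> U V; apply: uc_ext => x /=; tauto. Qed.

Fact ucIA : associative ucI.
Proof. by move=> U V W; apply: uc_ext => x /=; tauto. Qed.

Fact ucUA : associative ucU.
Proof. by move=> U V W; apply: uc_ext => x /=; tauto. Qed.

Fact ucUKI V U : ucI U (ucU U V) = U.
Proof. by apply: uc_ext => x /=; tauto. Qed.

Fact ucIKU V U : ucU U (ucI U V) = U.
Proof. by apply: uc_ext => x /=; tauto. Qed.

Fact ucIUl : left_distributive ucI ucU.
Proof. by move=> U V W; apply: uc_ext => x /=; tauto. Qed.

Fact ucII : idempotent_op ucI.
Proof. by move=> U; apply: uc_ext => x /=; tauto. Qed.

HB.instance Definition _ := Order.isMeetJoinDistrLattice.Build d upclopen
  uc_le_def uc_lt_def ucIC ucUC ucIA ucUA ucUKI ucIKU ucIUl ucII.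

Fact uc0_le U : uc0 <= U.
Proof. exact/asboolP. Qed.

Fact uc_leT U : U <= ucT.
Proof. exact/asboolP. Qed.

HB.instance Definition _ := Order.hasBottom.Build d upclopen uc0_le.
HB.instance Definition _ := Order.hasTop.Build d upclopen uc_leT.

End ClopenUpSets.
Arguments upclopen {d} X.

(** * Priestley spaces and their points as prime filters *)

Section Priestley.
Context {d : Order.disp_t} {X : POrderedTopological.type d}.
Hypothesis priestleyX : priestley_space X.

Lemma uc_sep (x y : X) : (forall U : upclopen X, U x -> U y) -> x <= y.
Proof.
move=> xy; apply: contrapT => /(priestleyX.2 _ _)[U [hU Ux]]; apply.
exact: (xy (UpClopen hU)).
Qed.

Lemma closed_above (x : X) : closed [set y | x <= y].
Proof.
move=> y cy; apply: uc_sep => U Ux; apply: (@uc_closed _ _ U) => B /cy[z [xz Bz]].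
by exists z; split=> //; exact: uc_up xz.
Qed.

Lemma closed_below (x : X) : closed [set y | y <= x].
Proof.
move=> y cy; apply: uc_sep => U Uy; have [|z [zx Uz]] := cy U.
  by apply: open_nbhs_nbhs; split=> //; exact: uc_open.
exact: uc_up zx.
Qed.

Lemma closed_singleton (x : X) : closed [set x].
Proof.
suff -> : [set x] = ([set y | (x <= y)%O] `&` [set y | (y <= x)%O])%classic.
  by apply: closedI; [exact: closed_above|exact: closed_below].
apply/seteqP; split=> [_ -> /=|y [xy yx]]; first by split; exact: lexx.
by apply/le_anti; rewrite xy andbT.
Qed.

(** The clopen up-sets containing [x] are directed and intersect in the principal up-set of [x]. *)
Lemma closed_meets_above (A : set X) (x : X) : closed A ->
  (forall U : upclopen X, U x -> exists2 y, A y & U y) ->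
  exists2 y, A y & x <= y.
Proof.
move=> cA meetA.
have cptA : compact A by apply: (subclosed_compact cA priestleyX.1).
have [||U V Ux Vx||y Ay xy] := @compact_bigcap_directed _ A _
  [set U : upclopen X | U x] (fun U => U) cptA.
- by move=> U _; exact: uc_closed.
- by exists ucT.
- by exists (ucI U V).
- exact: meetA.
- by exists y => //; exact: uc_sep.
Qed.

Lemma closed_down (A : set X) : closed A -> closed (down A).
Proof.
move=> cA x cx; have [|y Ay xy] := @closed_meets_above A x cA; last by exists y.
move=> U Ux; have [|z [[y [Ay zy]] Uz]] := cx U.
  by apply: open_nbhs_nbhs; split=> //; exact: uc_open.
by exists y => //; exact: uc_up zy.
Qed.

(** Zorn's lemma applies: over a nonempty chain in [C] the principal up-sets of its members are
    nested and closed, so compactness gives an upper bound in [C]. *)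
Lemma closed_has_maximal (C : set X) : closed C -> C !=set0 ->
  exists2 c, C c & forall c', C c' -> c <= c' -> c' = c.
Proof.
move=> cC [c0 Cc0].
have cptC : compact C by apply: (subclosed_compact cC priestleyX.1).
pose T := {x : X | C x}; pose R (u v : T) := sval u <= sval v.
have [||||[c Cc] maxc] := @Zorn T R.
- by move=> t; exact: lexx.
- by move=> r s t; exact: le_trans.
- move=> [s Cs] [t Ct]; rewrite /R /= => st ts; apply: eq_exist.
  by apply/le_anti; rewrite st ts.
(* The empty chain is bounded by [c0]; the compactness argument asks for a nonempty family. *)
- move=> A totA; have [A0|A0] := pselect (A !=set0); last first.
    by exists (exist _ c0 Cc0) => s As; case: A0; exists s.
  have [||s t As At|s As|x Cx xA] := @compact_bigcap_directed _ C _ A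
    (fun s => [set y | sval s <= y]) cptC.
  + by move=> s _; exact: closed_above.
  + by [].
  + by have [st|ts] := totA _ _ As At; [exists t|exists s] => // x xs; split=> //;
      [exact: le_trans st xs|exact: le_trans ts xs].
  + by exists (sval s); [exact: (svalP s)|exact: lexx].
  + by exists (exist _ x Cx) => s /xA.
- by exists c => // c' Cc' cc'; case: (maxc (exist _ c' Cc') cc').
Qed.

Lemma eps_prime_filter (x : X) : is_prime_filter [set U : upclopen X | U x].
Proof. by split=> // U V Ux /asboolP; exact. Qed.

Definition eps (x : X) : prime_filter (upclopen X) :=
  PrimeFilter (eps_prime_filter x).

Lemma eps_le x y : (eps x <= eps y) = (x <= y).
Proof.
by apply/pf_leP/idP => [h|xy U Ux]; [apply: uc_sep => U; exact: h|exact: uc_up xy].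
Qed.

Lemma uc_diff_closed (UV : upclopen X * upclopen X) :
  closed [set x | UV.1 x /\ ~ UV.2 x].
Proof.
by apply: closedI; [exact: uc_closed|apply: open_closedC; exact: uc_open].
Qed.

(** The differences of some [U] in [P] and some [V] outside [P] are closed, directed, and nonempty
    since otherwise [U <= V]. A common point belongs to exactly the members of [P]. *)
Lemma eps_surj (P : prime_filter (upclopen X)) : exists x, eps x = P.
Proof.
pose D := [set UV : upclopen X * upclopen X | P UV.1 /\ ~ P UV.2].
have [||[U V] [U' V'] [/= PU PV] [/= PU' PV']|[U V] [/= PU PV]|x _ Dx] :=
  @compact_bigcap_directed _ _ _ D (fun UV => [set x | UV.1 x /\ ~ UV.2 x])
    priestleyX.1.
- by move=> UV _; exact: uc_diff_closed.
- by exists (\top, \bot); split; [exact: pf_top|exact: pf_bot].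
- exists (U `&` U', V `|` V') => /=; last by move=> x /=; tauto.
  by split; [apply/pfIE|move=> /pfUE[]].
- apply: contrapT => h; apply: PV; apply: pf_up PU _; apply/asboolP => x Ux.
  by apply: contrapT => Vx; apply: h; exists x.
- exists x; apply: pf_ext => U; split=> [/= Ux|PU].
  + by apply: contrapT => PU; have [] := Dx (\top, U); [split=> //; exact: pf_top|].
  + by have [] := Dx (U, \bot); [split=> //; exact: pf_bot|].
Qed.

Lemma eps_continuous : continuous eps.
Proof.
apply/continuousP => A; rewrite pf_openE => oA; rewrite openE => x Ax.
have [U [V [Ux Vx AQ]]] := oA _ Ax.
rewrite /interior nbhsE; exists [set y | U y /\ ~ V y]; last by move=> y [Uy Vy]; exact: AQ.
split=> //; apply: openI; first exact: uc_open.
by apply: closed_openC; exact: uc_closed.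
Qed.

(** Needed for the continuity of the inverse of [eps]. The differences of clopen up-sets around [x]
    intersect in [x] alone, so by compactness one of them lies inside [A]; surjectivity of [eps]
    turns it into a basic open set. *)
Lemma eps_open (A : set X) : open A -> open (eps @` A).
Proof.
move=> oA; rewrite pf_openE => _ [x Ax <-].
have cptCA : compact (~` A)%classic.
  by apply: (subclosed_compact _ priestleyX.1) => //; exact: open_closedC.
suff [[U V] [/= Ux Vx] UVA] : exists2 UV : upclopen X * upclopen X,
    UV.1 x /\ ~ UV.2 x & [set y | UV.1 y /\ ~ UV.2 y] `<=` A.
  exists U, V; split=> // Q QU QV; have [y yQ] := eps_surj Q.
  by exists y => //; apply: UVA; split; [move: QU|move: QV]; rewrite -yQ.
apply: contrapT => h.
have [||[U V] [U' V'] [/= PU PV] [/= PU' PV']|[U V] [/= Ux Vx]|y Ay Dy] :=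
  @compact_bigcap_directed _ _ _
    [set UV : upclopen X * upclopen X | UV.1 x /\ ~ UV.2 x]
    (fun UV => [set x | UV.1 x /\ ~ UV.2 x]) cptCA.
- by move=> UV _; exact: uc_diff_closed.
- by exists (\top, \bot); split.
- by exists (U `&` U', V `|` V') => /= [|z /=]; tauto.
- apply: contrapT => h'; apply: h; exists (U, V) => // z [/= Uz Vz].
  by apply: contrapT => Az; apply: h'; exists z.
- suff xy : x = y by apply: Ay; rewrite -xy.
  apply/le_anti/andP; split; apply: uc_sep => U Ux.
  + by have [] := Dy (U, \bot); first by split.
  + by apply: contrapT => nUx; have [_ /(_ Ux)] := Dy (\top, U) (conj I nUx).
Qed.

End Priestley.

(** * The m-lattice of an mk-frame *)

Section FrameTheory.
Variable X : mk_frame.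
Implicit Types (U V : upclopen X) (x y z : X).

Local Notation ax := (mk_axioms X).

Fact uc_nab_subproof U : clopen_increasing (rel_image mkE U).
Proof.
split; [split|].
- by apply: (mk4 ax); exact: ucP.
- by apply: (mk3 ax); exact: uc_closed.
- move=> x y [u Uu ux] xy; have [w [uw wy]] := mk1 ax ux xy.
  by exists w => //; exact: uc_up uw.
Qed.
Definition uc_nab U := UpClopen (uc_nab_subproof U).

Fact uc_tri_subproof U :
  clopen_increasing (~` down (rel_image mkE (~` U)))%classic.
Proof.
split; [split|].
- apply: closed_openC; apply: (closed_down (mk2 ax)); apply: (mk3 ax).
  by apply: open_closedC; exact: uc_open.
- by apply: open_closedC; apply: (mk5 ax); exact: ucP.
- by move=> x y Ux xy [z [Ez yz]]; apply: Ux; exists z; split=> //; exact: le_trans yz.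
Qed.
Definition uc_tri U := UpClopen (uc_tri_subproof U).

(** Makes the composite of the order with [E] transitive. As [uc_tri] is the box operator of this
    composite ([uc_triP]), this yields [tri_tri] and [nab_tri]. *)
Lemma mkE_le_swap x y z v : mkE x y -> y <= z -> mkE z v ->
  exists2 w, x <= w & mkE w v.
Proof.
move=> xy yz zv; have [w [xw wz]] := mk1 ax xy yz.
by exists w => //; exact: (mk_trans ax _ zv).
Qed.

Lemma uc_triP U x : uc_tri U x <-> forall y z, x <= y -> mkE y z -> U z.
Proof.
split=> [h y z xy yz|h [y [[z Uz zy] xy]]].
  apply: contrapT => Uz; apply: h; exists y; split=> //; exists z => //.
  exact: (mk_sym ax yz).
by apply: Uz; apply: h xy _; exact: (mk_sym ax zy).
Qed.

Lemma upclopen_is_m_lattice : is_m_lattice uc_tri uc_nab.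
Proof.
split.
- by apply: uc_ext => x; split=> [[]|].
- move=> U; apply: uc_ext => x; split=> [[]//|Ux]; split=> //; exists x => //.
  exact: (mk_refl ax).
- move=> U V; apply: uc_ext => x; split=> [[y [Uy [z Vz zy]] yx]|].
    by split; [exists y|exists z => //; exact: (mk_trans ax _ yx)].
  move=> [[y Uy yx] [z Vz zx]]; exists y => //; split=> //; exists z => //.
  by apply: (mk_trans ax zx); exact: (mk_sym ax).
- move=> U V; apply: uc_ext => x; split=> [[y [Uy|Vy] yx]|[[y Uy yx]|[y Vy yx]]].
  + by left; exists y.
  + by right; exists y.
  + by exists y => //; left.
  + by exists y => //; right.
- move=> U; apply: uc_ext => x; split=> [[y [z Uz zy] yx]|[y Uy yx]].
    by exists z => //; exact: (mk_trans ax _ yx).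
  by exists y => //; exists y => //; exact: (mk_refl ax).
- by apply: uc_ext => x; split=> // _; apply/uc_triP.
- move=> U; apply: uc_ext => x; split=> [[]//|Ux]; split=> //.
  by move: Ux => /uc_triP; apply=> //; exact: (mk_refl ax).
- move=> U V; apply: uc_ext => x; split.
    by move=> /uc_triP h; split; apply/uc_triP => y z xy yz; have [] := h _ _ xy yz.
  by move=> [/uc_triP hU /uc_triP hV]; apply/uc_triP => y z xy yz; split;
    [exact: hU yz|exact: hV yz].
- move=> U; apply: uc_ext => x; split=> /uc_triP h; apply/uc_triP => y z xy yz.
    have /uc_triP := h _ _ xy yz; apply=> //; exact: (mk_refl ax).
  apply/uc_triP => t v zt tv.
  by have [w yw wv] := mkE_le_swap yz zt tv; apply: h wv; exact: le_trans yw.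
- move=> U; apply: uc_ext => x; split=> [[y /uc_triP h yx]|Ux]; last first.
    by exists x => //; exact: (mk_refl ax).
  apply/uc_triP => z t xz zt; have [w yw wt] := mkE_le_swap yx xz zt.
  exact: h wt.
(* For [tri_nab]: [uc_nab U] is both increasing and [E]-saturated. *)
- move=> U; apply: uc_ext => x; split=> [/uc_triP|Ux].
    by apply=> //; exact: (mk_refl ax).
  apply/uc_triP => y z xy yz; have [u Uu uy] := uc_up Ux xy.
  by exists u => //; exact: (mk_trans ax _ yz).
Qed.

Lemma upclopen_nontrivial : \bot <> \top :> upclopen X.
Proof.
move=> /(congr1 (fun U : upclopen X => uc_set U)) e.
have [x _] := mk_nonempty ax.
by have : uc_set (\bot : upclopen X) x by rewrite e.
Qed.

Definition uc_lattice : m_lattice :=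
  MLattice upclopen_nontrivial upclopen_is_m_lattice.

(* A maximal element of the class of [x] lies below an element of the class of
   [y], which in turn lies below an element of the class of [x]; hence the two
   classes meet. *)
Lemma mkE_sep x y :
  (forall U, uc_nab U x <-> uc_nab U y) -> mkE x y.
Proof.
have clE z : closed (rel_image mkE [set z]).
  by apply: (mk3 ax); exact: (closed_singleton (mk2 ax)).
(* The class of [t] meets every clopen up-set around [z], hence has a point above [z]; (mk1)
   transfers this from [z] to each [c] in its class. *)
have below z t : (forall U, uc_nab U z -> uc_nab U t) ->
    forall c, mkE z c -> exists2 e, mkE t e & c <= e.
  move=> zt c zc; have [|e [_ -> te] ze] := closed_meets_above (mk2 ax) (x := z) (clE t).
    move=> U Uz; have [|u Uu ut] := zt U; first by exists z => //; exact: (mk_refl ax).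
    by exists u => //; exists t => //; exact: (mk_sym ax).
  have [w [cw we]] := mk1 ax (mk_sym ax zc) ze; exists w => //.
  by apply: (mk_trans ax te); exact: (mk_sym ax).
move=> xy; have [|c [_ -> xc] maxc] := closed_has_maximal (mk2 ax) (clE x).
  by exists x, x => //; exact: (mk_refl ax).
have [e ye ce] := below x y (fun U => (xy U).1) _ xc.
have [c' xc' ec'] := below y x (fun U => (xy U).2) _ ye.
have ec : c' = c by apply: maxc; [exists x|exact: le_trans ec'].
have {}ec : c = e by apply/le_anti; rewrite ce -ec ec'.
by apply: (mk_trans ax xc); rewrite ec; exact: (mk_sym ax).
Qed.

Definition eps_frame (x : X) : pf_frame uc_lattice := eps x.

Lemma eps_E x y : mkE x y <-> mkE (eps_frame x) (eps_frame y).
Proof.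
split=> [xy U|xy]; last by apply: mkE_sep => U; exact: (xy U).
split=> -[z Uz zx]; exists z => //; first exact: (mk_trans ax _ xy).
by apply: (mk_trans ax zx); exact: (mk_sym ax).
Qed.

End FrameTheory.

(** * Isomorphisms of mk-frames *)

(** In (mkf2) and (mkf3) the required point is lifted along [g], so both hold with equality in place
    of the order. *)
Lemma is_mk_function_iso (X Y : mk_frame) (f : X -> Y) (g : Y -> X) :
    cancel g f -> {mono f : x y / x <= y} -> continuous f ->
    (forall x y, mkE x y <-> mkE (f x) (f y)) ->
  is_mk_function f.
Proof.
move=> gK f_le fc fE; split=> //.
- by move=> x y; rewrite f_le.
- by move=> x y /fE.
- move=> x y [_ -> xy]; exists y; split=> //; exists (g y) => //.
  by exists x => //; apply/fE; rewrite gK.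
- move=> x z [y [_ [-> xy]] yz]; exists z; split=> //; exists (g z) => //.
  by exists (g y); [exists x; split=> //; rewrite -f_le gK|apply/fE; rewrite !gK].
Qed.

(** Reflection of the order gives injectivity by antisymmetry, openness gives continuity of the
    inverse, and [is_mk_function_iso] then applies to that inverse. *)
Lemma mk_function_iso (X Y : mk_frame) (f : mk_function X Y) :
    (forall y, exists x, f x = y) -> {mono f : x y / x <= y} ->
    (forall A, open A -> open (f @` A)) ->
    (forall x y, mkE x y <-> mkE (f x) (f y)) ->
  exists g : mk_function Y X, mkf_comp g f = mkf_id X /\ mkf_comp f g = mkf_id Y.
Proof.
move=> /choice[g gK] f_le fo fE.
have fK : cancel f g.
  by move=> x; apply/le_anti; rewrite -!f_le gK lexx.
have hg : is_mk_function g.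
  apply: (is_mk_function_iso fK).
  - by move=> x y; rewrite -f_le !gK.
  - apply/continuousP => A /fo; congr open; apply/seteqP; split=> [_ [x Ax <-]|y Ay].
      by rewrite /preimage /= fK.
    by exists (g y).
  - by move=> x y; rewrite -{1}(gK x) -{1}(gK y) -fE.
by exists (MkFunction hg); split; apply: mk_function_ext.
Qed.

Lemma eps_is_mk_function (X : mk_frame) : is_mk_function (@eps_frame X).
Proof.
have pX := mk2 (mk_axioms X); have /choice[g gK] := eps_surj pX.
apply: (@is_mk_function_iso X (pf_frame (uc_lattice X)) (@eps_frame X) g gK).
- exact: (eps_le pX).
- exact: eps_continuous.
- exact: eps_E.
Qed.

Definition eps_mkf (X : mk_frame) : mk_function X (pf_frame (uc_lattice X)) :=
  MkFunction (@eps_is_mk_function X).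

(** * The homomorphism dual to an mk-function *)

Section FrameMap.
Variables (X Y : mk_frame) (f : mk_function X Y).

Fact uc_map_subproof (U : upclopen Y) : clopen_increasing (f @^-1` U).
Proof.
have [fh fc _ _ _] := mk_functionP f; split; [split|].
- by apply: open_comp => [x _|]; [exact: fc|exact: uc_open].
- by apply: closed_comp => [x _|]; [exact: fc|exact: uc_closed].
- by move=> x y Ux xy; apply: uc_up Ux _; exact: fh.
Qed.

Definition uc_map (U : uc_lattice Y) : uc_lattice X :=
  UpClopen (uc_map_subproof U).

(** For both operators one inclusion rests on (mkf1). The other is (mkf3) for [tri], which finds an
    image below the given point, and (mkf2) for [nab], which finds one above it. *)
Lemma uc_map_is_m_hom : is_m_hom uc_map.
Proof.
have [fh _ f1 f2 f3] := mk_functionP f; split.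
- exact: uc_ext.
- exact: uc_ext.
- by move=> U V; exact: uc_ext.
- by move=> U V; exact: uc_ext.
- move=> U; apply: uc_ext => x; split=> /uc_triP h; apply/uc_triP => y z.
    by move=> xy yz; apply: h (f1 _ _ yz); exact: fh.
  move=> xy yz; have [|_ [[w [t [_ [-> xt]] tw] <-] wz]] := f3 x z.
    by exists y => //; exists (f x).
  by apply: uc_up wz; exact: h tw.
- move=> U; apply: uc_ext => x; split=> [[y Uy yx]|[y Uy yx]]; last first.
    by exists (f y) => //; exact: f1.
  have [|_ [[w [_ -> xw] <-] yw]] := f2 x y.
    by exists (f x) => //; exact: (mk_sym (mk_axioms Y) yx).
  by exists w; [exact: uc_up yw|exact: (mk_sym (mk_axioms X) xw)].
Qed.

Definition uc_hom : m_hom (uc_lattice Y) (uc_lattice X) := MHom uc_map_is_m_hom.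

End FrameMap.

(** * The representation of an m-lattice by clopen up-sets *)

Section RepresentationHom.
Variable L : m_lattice.

Definition phi_uc (a : L) : uc_lattice (pf_frame L) :=
  UpClopen (phi_clopen_increasing a).

Lemma phi_is_m_hom : is_m_hom phi_uc.
Proof.
split.
- by apply: uc_ext => P; split=> // /pf_bot.
- by apply: uc_ext => P; split=> // _; exact: pf_top.
- by move=> a b; apply: uc_ext => P; exact: pfIE.
- by move=> a b; apply: uc_ext => P; exact: pfUE.
- by move=> a; apply: uc_ext => P; rewrite /= phi_tri.
- by move=> a; apply: uc_ext => P; rewrite /= phi_nab.
Qed.

Definition phi_hom : m_hom L (uc_lattice (pf_frame L)) := MHom phi_is_m_hom.

End RepresentationHom.

Lemma m_hom_iso (L M : m_lattice) (h : m_hom L M) :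
  injective h -> (forall b, exists a, h a = b) ->
  exists g : m_hom M L, m_comp g h = m_id L /\ m_comp h g = m_id M.
Proof.
move=> hinj /choice[g gK]; have hK : cancel h g by move=> a; exact: hinj.
have [h0 h1 hI hU hT hN] := m_homP h.
have hg : is_m_hom g.
  by split=> [||x y|x y|x|x]; apply: hinj; rewrite gK ?h0 ?h1 ?hI ?hU ?hT ?hN ?gK.
by exists (MHom hg); split; apply: m_hom_ext.
Qed.

(** * The two functors and the duality *)

Lemma naturally_isomorphic_sym (C D : category) (F G : functor C D) :
  naturally_isomorphic F G -> naturally_isomorphic G F.
Proof.
move=> [eta [nat_eta iso_eta]]; pose inv a := sval (cid (iso_eta a)).
have invP a : compc (inv a) (eta a) = idc (F a) /\ compc (eta a) (inv a) = idc (G a).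
  exact: svalP (cid (iso_eta a)).
exists inv; split=> [a b f|a].
- have [_ eb] := invP a; have [ib _] := invP b.
  rewrite -[LHS]compc1 -eb [LHS]compcA -(compcA (inv b)) -nat_eta.
  by rewrite (compcA (inv b)) ib comp1c.
- by have [l r] := invP a; exists (eta a).
Qed.

Definition spec_functor : functor M_cat (opposite mKF_cat).
Proof.
refine (@Functor M_cat (opposite mKF_cat) pf_frame (fun L M h => pf_mkf h) _ _).
- by move=> L; apply: mk_function_ext => P; exact: pf_ext.
- by move=> L M N f g; apply: mk_function_ext => P; exact: pf_ext.
Defined.

Definition upclopen_functor : functor (opposite mKF_cat) M_cat.
Proof.
refine (@Functor (opposite mKF_cat) M_cat uc_lattice (fun X Y f => uc_hom f) _ _).
- by move=> X; apply: m_hom_ext => U; exact: uc_ext.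
- by move=> X Y Z f g; apply: m_hom_ext => U; exact: uc_ext.
Defined.

Theorem theorem3p1 : dually_equivalent M_cat mKF_cat.
Proof.
exists spec_functor, upclopen_functor; split.
(* [phi_hom] runs from the identity to the double dual, so the direction has to be reversed. *)
- apply: naturally_isomorphic_sym; exists phi_hom; split.
  + by move=> L M h; apply: m_hom_ext => a; exact: uc_ext.
  + move=> L; apply: m_hom_iso => [a b|U].
      by move=> /(congr1 (fun V : upclopen _ => V : set _)); exact: phi_inj.
    have [a Ua] := phi_surj (ucP U); exists a; apply: uc_ext => P.
    by rewrite Ua.
(* No reversal here: in the opposite category, [eps_mkf X] already runs from the double dual to
   [X]. *)
- exists (fun X => eps_mkf X : @hom (opposite mKF_cat) _ _); split.
  + by move=> X Y f; apply: mk_function_ext => y; exact: pf_ext.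
  + move=> X; have [||||g [gf fg]] := @mk_function_iso _ _ (eps_mkf X).
    * exact: (eps_surj (mk2 (mk_axioms X))).
    * exact: (eps_le (mk2 (mk_axioms X))).
    * exact: (eps_open (mk2 (mk_axioms X))).
    * exact: eps_E.
    * by exists g.
Qed.
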